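(* Fix the number of knapsacks $m\ge 1$. For every fixed $0<\alpha<1$, the branch-and-bound algorithm $A^{\text{knap}}_{\alpha}$ (described in the context), run on any instance of the multiple knapsack problem with $n$ items and $m$ knapsacks, returns a feasible solution whose profit is at least $\alpha$ times the optimal profit, after processing $O\!\left(n^{c_{\alpha,m}+1}\cdot m^{c_{\alpha,m}}\right)$ nodes of the branching tree, where $c_{\alpha,m}$ is a constant depending only on $\alpha$ and $m$.
   Context: Multiple knapsack problem: $n$ items with nonnegative integer weights $w_1,\dots,w_n$ and profits $p_1,\dots,p_n$, and $m$ knapsacks with nonnegative integer capacities $C_1,\dots,C_m$. A solution assigns each item to at most one knapsack (variables $x_{j,i}\in\{0,1\}$, $\sum_i x_{j,i}\le 1$) so that $\sum_j w_jx_{j,i}\le C_i$ for every $i$; the goal is to maximize $\sum_{j,i}p_jx_{j,i}$. Bounding subroutine on a (sub)instance $(\mathbf C,\mathbf w,\mathbf p)$: sort the items by decreasing $p_j/w_j$ (relabel so this order is $1,\dots,n$). Fill knapsack $1$, then $2$, etc., greedily in this order; when an item does not fit entirely in the current knapsack, the part that fits is put there and the excess is put in the next knapsack. This gives an optimal solution $\mathbf x^*$ of the LP relaxation. For $k=1,\dots,m$ the critical item relative to knapsack $k$ is $s_k=\min\{j:\sum_{l=1}^j w_l>\sum_{i=1}^k C_i\}$ (when it exists); set $s_0=0$. Let $\mathbf x'$ be the most profitable among the integer solutions consisting of a single critical item $s_k$ alone, and $\lfloor\mathbf x^*\rfloor$; its profit is $\max\{p_{s_1},\dots,p_{s_m},\sum_{k}\sum_{j=s_{k-1}+1}^{s_k-1}p_j\}$.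 The best critical item $j^*$ is the critical item of maximum profit. Algorithm $A^{\text{knap}}_{\alpha}$: each node $v$ of the branching tree is specified by a set of items fixed into given knapsacks (item $j_z$ in knapsack $i_z$, $z=1,\dots,k$) and a set of excluded items; it encodes the subinstance on the remaining items with capacities $C_i-\sum_{z:i_z=i}w_{j_z}$. On $v$ the bounding subroutine is applied to this subinstance, giving values $SUB(v)=\mathbf p\cdot\mathbf x^*$ and $SLB(v)=\mathbf p\cdot\mathbf x'$; set $UB(v)=SUB(v)+\sum_z p_{j_z}$ and $LB(v)=SLB(v)+\sum_z p_{j_z}$ (the latter is the profit of a feasible solution of the original instance). Branching: $v$ gets $m+1$ children; for $i\le m$ the $i$-th child additionally fixes the best critical item $j^*$ of $v$ into knapsack $i$ (reducing its remaining capacity by $w_{j^*}$), and the $(m+1)$-th child excludes $j^*$. A child is pruned if it is infeasible (e.g. $j^*$ does not fit in knapsack $i$) or its upper bound is lower than the profit of an already found feasible solution; otherwise it becomes active. Selection (best-first): the active node with the largest $UB$ is processed next. The algorithm maintains $HUB=\max\{UB(w): w \text{ active}\}$ and $HLB$ = the largest $LB$ of a visited node, and terminates as soon as $HLB/HUB\ge\alpha$, returning the best feasible solution found.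
   Formalization: The profit formula for x' counts critical items that fit in no knapsack, and then LB need not be the profit of a feasible solution; here a critical item alone is a candidate only if it fits in some knapsack's remaining capacity, and the rounded-down LP solution is taken literally. *)

(* Defs.v *)
From mathcomp Require Export all_boot all_order all_algebra.
From mathcomp Require Export reals.

Set Implicit Arguments.
Unset Strict Implicit.
Unset Printing Implicit Defensive.

Import Order.TTheory GRing.Theory Num.Theory.

Local Open Scope nat_scope.

Record instance (n m : nat) := Instance {
  weight : 'I_n -> nat;
  profit : 'I_n -> nat;
  capacity : 'I_m -> nat }.

(* 0/1 matrices: [x j i] says that item [j] is put into knapsack [i]. *)
Notation solution n m := 'M[bool]_(n, m).

Definition value n m (I : instance n m) (x : solution n m) : nat :=
  \sum_(j < n) \sum_(i < m) profit I j * x j i.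

Definition feasible n m (I : instance n m) (x : solution n m) : bool :=
  [forall j, \sum_(i < m) (x j i : nat) <= 1] &&
  [forall i, \sum_(j < n) weight I j * x j i <= capacity I i].

Definition opt n m (I : instance n m) : nat :=
  \max_(x : solution n m | feasible I x) value I x.

Record node (n m : nat) := Node {
  fixed : {set 'I_n * 'I_m};
  excluded : {set 'I_n} }.

Definition root n m : node n m := Node set0 set0.

Definition remaining n m (v : node n m) : {set 'I_n} :=
  [set j | (j \notin excluded v) && [forall i, (j, i) \notin fixed v]].

(* The subtraction never truncates on nodes reached by the algorithm. *)
Definition residual n m (I : instance n m) (v : node n m) (i : 'I_m) : nat :=
  capacity I i - \sum_(z in fixed v | z.2 == i) weight I z.1.

(* [profit / weight] is read as infinite for a weightless item, which is
   therefore sorted before all items of positive weight. *)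
Definition denser n m (I : instance n m) (j l : 'I_n) : bool :=
  (weight I j == 0) ||
  (weight I l != 0) &&
  ((profit I l)%:R / (weight I l)%:R <=
     (profit I j)%:R / (weight I j)%:R :> rat)%R.

(* How an amount [a] spreads over knapsacks with free space [r], filled one
   after the other. *)
Definition pour m (r : 'I_m -> nat) (a : nat) (i : 'I_m) : nat :=
  minn (r i) (a - \sum_(k < m | k < i) r k).

Fixpoint greedy_load n m (w : 'I_n -> nat) (r : 'I_m -> nat) (s : seq 'I_n)
    (j : 'I_n) (i : 'I_m) : nat :=
  if s is l :: s' then
    if j == l then pour r (w l) i
    else greedy_load w (fun k => r k - pour r (w l) k) s' j i
  else 0.

(* The greedy LP solution for the item order [s] and the capacities [r]. In a
   sorted order, weightless items precede all others, hence are put, whole,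
   into the first knapsack. *)
Definition lp_solution n m (I : instance n m) (r : 'I_m -> nat)
    (s : seq 'I_n) : 'M[rat]_(n, m) :=
  (\matrix_(j, i)
    if j \notin s then 0
    else if weight I j == 0%N then ((i : nat) == 0%N)%:R
    else (greedy_load (weight I) r s j i)%:R / (weight I j)%:R)%R.

(* Entries of [lp_solution] lie in [0, 1], so their floors are 0 or 1. *)
Definition lp_floor n m (I : instance n m) (r : 'I_m -> nat)
    (s : seq 'I_n) : solution n m :=
  (\matrix_(j, i) (Num.truncn (lp_solution I r s j i) != 0%N))%R.

Definition weight_through n m (I : instance n m) (s : seq 'I_n)
    (j : 'I_n) : nat :=
  \sum_(l <- take (index j s).+1 s) weight I l.

Definition critical_for n m (I : instance n m) (r : 'I_m -> nat)
    (s : seq 'I_n) (k : 'I_m) (j : 'I_n) : bool :=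
  let cap := \sum_(i < m | i <= k) r i in
  [&& j \in s, cap < weight_through I s j &
      all (fun l => weight_through I s l <= cap) (take (index j s) s)].

Definition critical n m (I : instance n m) (r : 'I_m -> nat)
    (s : seq 'I_n) (j : 'I_n) : bool :=
  [exists k, critical_for I r s k j].

(* A critical item taken alone is a solution of the subinstance only in a
   knapsack where it fits, and it may fit in none. *)
Definition candidate n m (I : instance n m) (r : 'I_m -> nat)
    (s : seq 'I_n) (x : solution n m) : bool :=
  (x == lp_floor I r s) ||
  [exists j, exists i,
     [&& critical I r s j, weight I j <= r i &
         x == (\matrix_(l, k) ((l, k) == (j, i)))%R]].

(* A node together with an outcome of the bounding subroutine on its
   subinstance: ties, in the item order and in the choice of the integer
   solution, may be broken in any way, independently at each node. *)
Record visited (n m : nat) := Visited {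
  vnode : node n m;
  order : seq 'I_n;
  subsol : solution n m }.

Definition bounded n m (I : instance n m) (v : visited n m) : bool :=
  let r := residual I (vnode v) in
  [&& perm_eq (order v) (enum (remaining (vnode v))),
      sorted (denser I) (order v),
      candidate I r (order v) (subsol v) &
      [forall y, candidate I r (order v) y ==>
                 (value I y <= value I (subsol v))]].

Definition best_critical n m (I : instance n m) (v : visited n m)
    (j : 'I_n) : bool :=
  let crit := critical I (residual I (vnode v)) (order v) in
  crit j && [forall l, crit l ==> (profit I l <= profit I j)].

Definition SUB n m (I : instance n m) (v : visited n m) : rat :=
  (\sum_(j < n) \sum_(i < m)
     (profit I j)%:R * lp_solution I (residual I (vnode v)) (order v) j i)%R.

Definition SLB n m (I : instance n m) (v : visited n m) : nat :=
  value I (subsol v).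

Definition fixed_profit n m (I : instance n m) (v : visited n m) : nat :=
  \sum_(z in fixed (vnode v)) profit I z.1.

Definition UB n m (I : instance n m) (v : visited n m) : rat :=
  (SUB I v + (fixed_profit I v)%:R)%R.

Definition LB n m (I : instance n m) (v : visited n m) : nat :=
  SLB I v + fixed_profit I v.

(* The solution of the original instance witnessing [LB]. *)
Definition full_solution n m (v : visited n m) : solution n m :=
  (\matrix_(j, i) (((j, i) \in fixed (vnode v)) || subsol v j i))%R.

(* Branching on item [j], infeasible children being left out. *)
Definition children n m (I : instance n m) (v : node n m) (j : 'I_n) :
    seq (node n m) :=
  rcons [seq Node ((j, i) |: fixed v) (excluded v)
          | i <- enum 'I_m & weight I j <= residual I v i]
        (Node (fixed v) (j |: excluded v)).

Record state (n m : nat) := State {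
  active : seq (visited n m);
  incumbent : solution n m;
  HLB : nat }.

(* All upper bounds are nonnegative; the maximum is 0 if no node is active. *)
Definition HUB n m (I : instance n m) (st : state n m) : rat :=
  (\big[Num.max/0]_(v <- active st) UB I v)%R.

(* HLB / HUB >= alpha, cleared of its denominator: a vanishing HUB, and in
   particular an empty list of active nodes, also stops the algorithm. *)
Definition stopped (R : realType) (alpha : R) n m (I : instance n m)
    (st : state n m) : bool :=
  (alpha * ratr (HUB I st) <= (HLB st)%:R)%R.

Definition initial n m (I : instance n m) (st : state n m) : Prop :=
  exists v : visited n m,
    [/\ vnode v = root n m, bounded I v &
        st = State [:: v] (full_solution v) (LB I v)].

(* Processing one node [v]: its children [bs] are bounded, the lower bound and
   a solution attaining it are updated, and the children whose upper bound is
   not below the updated lower bound become active. *)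
Definition step (R : realType) (alpha : R) n m (I : instance n m)
    (st st' : state n m) : Prop :=
  ~~ stopped alpha I st /\
  exists (s1 s2 : seq (visited n m)) (v : visited n m) (j : 'I_n)
         (bs : seq (visited n m)),
    [/\ active st = s1 ++ v :: s2 /\ UB I v = HUB I st,
        best_critical I v j,
        map (@vnode n m) bs = children I (vnode v) j /\ all (bounded I) bs,
        HLB st' = maxn (HLB st) (\max_(b <- bs) LB I b) /\
        (incumbent st', HLB st') \in
          (incumbent st, HLB st) :: [seq (full_solution b, LB I b) | b <- bs] &
        active st' =
          s1 ++ s2 ++ [seq b <- bs | ((HLB st')%:R <= UB I b)%R]].

(* [run alpha I t st]: [st] is reachable after processing [t] nodes. *)
Inductive run (R : realType) (alpha : R) n m (I : instance n m) :
    nat -> state n m -> Prop :=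
| run_start st : initial I st -> run alpha I 0 st
| run_step t st st' :
    run alpha I t st -> step alpha I st st' -> run alpha I t.+1 st'.

(* Main.v *)
Require Import Defs.
From HB Require Import structures.
From mathcomp Require Import zify ring lra.

(* Let [v] be processed while the algorithm does not stop. The greedy LP
   solution of [v] differs from its floor only at critical items, at most one
   per knapsack, so [UB v - LB v <= m * p_j] for the best critical item [j];
   since [LB v < alpha * UB v], this gives [m * p_j > (1 - alpha) * UB v]. Upper
   bounds decrease along branches, hence every item fixed at [v] satisfies that
   inequality too, and as the fixed profit is at most [UB v], fewer than
   [c + 1] items are fixed at [v], where [c] is the integer part of
   [m / (1 - alpha)]. The processed nodes thus form a tree of depth at most [n]
   in which at most [c] edges of a branch fix an item, in at most [m] ways
   each. Correctness holds because every feasible solution of value above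
   [HLB] extends the partial assignment of some active node, whose upper bound
   therefore dominates its value. *)

Set Implicit Arguments.
Unset Strict Implicit.
Unset Printing Implicit Defensive.

Import Order.TTheory GRing.Theory Num.Theory.

Local Open Scope nat_scope.

(** * The greedy distribution of items *)

Lemma sum_ltnS m (F : 'I_m -> nat) (i : 'I_m) :
  \sum_(k < m | k < i.+1) F k = \sum_(k < m | k < i) F k + F i.
Proof.
rewrite (bigD1 i) //= addnC; congr (_ + _); apply: eq_bigl => k.
by rewrite ltnS andbC -ltn_neqAle.
Qed.

(** Filling in order, the first knapsacks take as much of [a] as their joint space allows. The index
    [i] is any natural number, so the induction also passes beyond [m], where the prefix stops
    growing. *)
Lemma sum_pour_lt m (r : 'I_m -> nat) a i :
  \sum_(k < m | k < i) pour r a k = minn (\sum_(k < m | k < i) r k) a.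
Proof.
elim: i => [|i IH]; first by rewrite !big_pred0 // min0n.
have [lt_im|le_mi] := ltnP i m.
  have := sum_ltnS (pour r a) (Ordinal lt_im);
    have := sum_ltnS r (Ordinal lt_im).
  by rewrite /pour /= => -> ->; move: IH; rewrite /pour /= => ->; lia.
have E (F : 'I_m -> nat) :
  \sum_(k < m | k < i.+1) F k = \sum_(k < m | k < i) F k.
  by apply: eq_bigl => k; have := ltn_ord k; lia.
by rewrite !E.
Qed.

Lemma sum_pour m (r : 'I_m -> nat) a :
  \sum_(k < m) pour r a k = minn (\sum_(k < m) r k) a.
Proof.
have E (F : 'I_m -> nat) : \sum_(k < m) F k = \sum_(k < m | k < m) F k.
  by apply: eq_bigl => k; rewrite ltn_ord.
by rewrite !E sum_pour_lt.
Qed.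

Lemma pour_le m (r : 'I_m -> nat) a i : pour r a i <= r i.
Proof. exact: geq_minl. Qed.

(** After pouring [a], a prefix of total space [P] has [P - minn P a] left; the rest is arithmetic.
    This lets the recursion of [greedy_load] telescope. *)
Lemma pourD m (r : 'I_m -> nat) a b i :
  pour r (a + b) i = pour r a i + pour (fun k => r k - pour r a k) b i.
Proof.
have := sum_pour_lt r a i; rewrite [pour r (a + b) i]/pour.
rewrite [pour (fun k => _) b i]/pour /=.
rewrite sumnB; last by move=> k _; apply: pour_le.
move=> ->; rewrite /pour.
move: (\sum_(k < m | k < i) r k) => P; lia.
Qed.

Lemma pour0 m (r : 'I_m -> nat) i : pour r 0 i = 0.
Proof. by rewrite /pour sub0n minn0. Qed.

Section Greedy.
Variables (n m : nat) (I : instance n m).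
Notation w := (weight I).
Notation p := (profit I).

(** On a line measuring total weight, item [j] occupies the interval from [weight_before s j] to
    [weight_through I s j]; knapsack boundaries are the prefix sums of the capacities on the same
    line. *)
Definition weight_before (s : seq 'I_n) j := \sum_(l <- take (index j s) s) w l.

Lemma weight_throughE (s : seq 'I_n) j :
  j \in s -> weight_through I s j = weight_before s j + w j.
Proof.
move=> js; rewrite /weight_through /weight_before (take_nth j) ?index_mem //.
by rewrite nth_index // -cats1 big_cat big_seq1.
Qed.

Lemma sum_take_le (F : 'I_n -> nat) (s : seq 'I_n) a b :
  a <= b -> \sum_(l <- take a s) F l <= \sum_(l <- take b s) F l.
Proof.
move=> le_ab; rewrite -(cat_take_drop a (take b s)) big_cat /=.
by rewrite take_takel // leq_addr.
Qed.

Lemma weight_through_le s j l :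
  index j s < index l s -> weight_through I s j <= weight_before s l.
Proof. exact: sum_take_le. Qed.

Lemma weight_through_le_sum s j : weight_through I s j <= \sum_(l <- s) w l.
Proof.
rewrite -[s in X in _ <= X]take_size /weight_through.
have [h|h] := leqP (index j s).+1 (size s); first exact: sum_take_le.
by rewrite take_oversize ?take_size // ltnW.
Qed.

(** Closed form of the greedy recursion, by telescoping [pourD]; written additively to avoid
    subtraction in [nat]. *)
Lemma greedy_loadE (r : 'I_m -> nat) s j i : j \in s ->
  pour r (weight_before s j) i + greedy_load w r s j i =
  pour r (weight_through I s j) i.
Proof.
elim: s r => // l s IH r; rewrite inE => jls.
rewrite weight_throughE ?inE // /weight_before /=.
case: eqVneq jls => [<- _|ne /= js].
  by rewrite /= big_nil pour0.
rewrite big_cons -!addnA !(pourD _ (w l)) -weight_throughE // -addnA.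
by congr (_ + _); apply: IH.
Qed.

Lemma greedy_load_notin (r : 'I_m -> nat) s j i :
  j \notin s -> greedy_load w r s j i = 0.
Proof.
elim: s r => //= l s IH r; rewrite inE negb_or => /andP[/negPf-> js].
exact: IH.
Qed.

Lemma sum_greedy_load_items (r : 'I_m -> nat) s i : uniq s ->
  \sum_(j < n) greedy_load w r s j i = pour r (\sum_(l <- s) w l) i.
Proof.
elim: s r => [|l s IH] r /=; first by rewrite big_nil pour0 big1.
move=> /andP[ls us]; rewrite big_cons pourD -IH // (bigD1 l) //= eqxx.
congr (_ + _); rewrite [RHS](bigD1 l) //= greedy_load_notin // add0n.
by apply: eq_bigr => j /negPf->.
Qed.

Lemma sum_greedy_load (r : 'I_m -> nat) s j : j \in s ->
  minn (\sum_i r i) (weight_before s j) + \sum_(i < m) greedy_load w r s j i =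
  minn (\sum_i r i) (weight_through I s j).
Proof.
move=> js; rewrite -!sum_pour -big_split /=.
by apply: eq_bigr => i _; rewrite greedy_loadE.
Qed.

Lemma critical_forI (r : 'I_m -> nat) s (k : 'I_m) j : j \in s ->
  weight_before s j <= \sum_(i < m | i <= k) r i < weight_through I s j ->
  critical_for I r s k j.
Proof.
move=> js /andP[h1 h2]; rewrite /critical_for js h2 /=.
apply/allP => l ls; apply: leq_trans h1; apply: weight_through_le.
by move: ls; rewrite in_take_leq ?index_size.
Qed.

(** Of two distinct such items the earlier already exceeds the capacity, against the minimality of
    the later. This is the source of the factor [m] in the gap between the bounds. *)
Lemma critical_for_inj (r : 'I_m -> nat) s (k : 'I_m) j l :
  critical_for I r s k j -> critical_for I r s k l -> j = l.
Proof.
have W a b : critical_for I r s k a -> critical_for I r s k b ->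
    index b s <= index a s.
  move=> /and3P[as_ ha _] /and3P[bs _ /allP hb]; rewrite leqNgt.
  apply/negP => lt_ab; suff /hb : a \in take (index b s) s by rewrite leqNgt ha.
  by rewrite in_take.
move=> cj cl; have [js ls] : j \in s /\ l \in s.
  by case/and3P: cj => ->; case/and3P: cl => ->.
have eq_jl : index j s = index l s by apply/eqP; rewrite eqn_leq !W.
by rewrite -(nth_index j js) eq_jl nth_index.
Qed.

Lemma exists_threshold (s : seq 'I_n) S : uniq s -> S < \sum_(l <- s) w l ->
  exists j, [/\ j \in s, weight_before s j <= S & S < weight_through I s j].
Proof.
move=> us lt_S.
(* The least prefix length whose weight exceeds [S] is positive, and the last item of that prefix is
   the one sought. *)
have : exists k, S < \sum_(l <- take k s) w l by exists (size s);
  rewrite take_size.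
move=> /ex_minnP[[|k]]; first by rewrite take0 big_nil.
move=> lt_Sk min_k; have le_kS : \sum_(l <- take k s) w l <= S.
  by rewrite leqNgt; apply/negP => /min_k; rewrite ltnn.
case: s us lt_S lt_Sk {min_k} le_kS => [|x0 s] us lt_S lt_Sk le_kS.
  by rewrite big_nil in lt_S.
have lt_k : k < size (x0 :: s).
  rewrite ltnNge; apply/negP => le_k; move: lt_Sk le_kS.
  by rewrite (take_oversize (leqW le_k)) (take_oversize le_k) ltnNge => /negP.
exists (nth x0 (x0 :: s) k); split; first exact: mem_nth.
  by rewrite /weight_before index_uniq.
by rewrite /weight_through index_uniq.
Qed.
End Greedy.

(** * The linear relaxation *)

Section LinearRelaxation.
Variables (n m : nat) (I : instance n m).
Notation w := (weight I).
Notation p := (profit I).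

Lemma denser_trans : transitive (denser I).
Proof.
move=> l j k; rewrite /denser; case: eqVneq => //= _ /andP[wl le_jl].
by rewrite (negPf wl) /= => /andP[-> /le_trans->].
Qed.

Lemma denser_total : total (denser I).
Proof.
move=> j l; rewrite /denser; case: (eqVneq (w j)) => //= _.
by case: (eqVneq (w l)) => //= _; apply: le_total.
Qed.

Variables (r : 'I_m -> nat) (s : seq 'I_n).
Hypotheses (m_gt0 : 0 < m) (uniq_s : uniq s).
Notation x := (lp_solution I r s).

Local Open Scope ring_scope.

Lemma lp_solution_ge0 j i : 0 <= x j i.
Proof.
rewrite mxE; case: ifP => // _; case: ifP => _; first exact: ler0n.
by rewrite divr_ge0 ?ler0n.
Qed.

Lemma lp_solution_notin j i : j \notin s -> x j i = 0.
Proof. by rewrite mxE => ->. Qed.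

Lemma weight_lp_solution j i :
  (w j)%:R * x j i = (greedy_load w r s j i)%:R.
Proof.
rewrite mxE; have [js|js] := boolP (j \in s); last first.
  by rewrite mulr0 greedy_load_notin.
have := greedy_loadE I r i js; rewrite (weight_throughE _ js) /=.
have [->|w0] := eqVneq (w j) 0%N.
  by rewrite mul0r addn0 => /eqP; rewrite -[eqbRHS]addn0 eqn_add2l => /eqP->.
by rewrite mulrC divfK // pnatr_eq0.
Qed.

Lemma lp_solution_row j : j \in s ->
  (w j)%:R * (\sum_i x j i) + (minn (\sum_i r i) (weight_before I s j))%:R =
  (minn (\sum_i r i) (weight_through I s j))%:R.
Proof.
move=> js; rewrite mulr_sumr -(sum_greedy_load I r js) addrC natrD natr_sum.
by congr (_ + _); apply: eq_bigr => i _; rewrite weight_lp_solution.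
Qed.

Lemma lp_solution_row_weightless j : j \in s -> w j = 0%N -> \sum_i x j i = 1.
Proof.
move=> js w0;
  rewrite (bigD1 (Ordinal m_gt0)) //= mxE js w0 eqxx /= big1 ?addr0 //.
move=> i ne_i0; rewrite mxE js w0 eqxx; case: eqP => // i0.
by case/eqP: ne_i0; apply: val_inj.
Qed.

Lemma lp_solution_row_le1 j : \sum_i x j i <= 1.
Proof.
have [js|js] := boolP (j \in s); last first.
  by rewrite big1 // => i _; rewrite lp_solution_notin.
have [w0|w0] := eqVneq (w j) 0%N; first by rewrite lp_solution_row_weightless.
have wj : 0 < (w j)%:R :> rat by rewrite ltr0n lt0n.
rewrite -(ler_pM2l wj) mulr1 -(lerD2r (minn (\sum_i r i) (weight_before I s j))%:R).
rewrite lp_solution_row // -natrD ler_nat (weight_throughE _ js); lia.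
Qed.

Lemma lp_solution_row_full j : j \in s ->
  (weight_through I s j <= \sum_i r i)%N -> \sum_i x j i = 1.
Proof.
move=> js; have [w0|w0] := eqVneq (w j) 0%N.
  by rewrite lp_solution_row_weightless.
have wj : (w j)%:R != 0 :> rat by rewrite pnatr_eq0.
have := lp_solution_row js; rewrite (weight_throughE _ js) => + le_r.
rewrite !(minn_idPr _) //; last by lia.
by rewrite natrD addrC => /addrI; rewrite -[RHS]mulr1 => /(mulfI wj).
Qed.

Lemma lp_solution_row_empty j : w j != 0%N ->
  (\sum_i r i <= weight_before I s j)%N -> \sum_i x j i = 0.
Proof.
move=> w0 le_r; have [js|js] := boolP (j \in s); last first.
  by rewrite big1 // => i _; rewrite lp_solution_notin.
have := lp_solution_row js; rewrite (weight_throughE _ js).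
rewrite !(minn_idPl _) //; last by lia.
move=> /eqP; rewrite -[eqbRHS]add0r => /eqP/addIr/eqP.
by rewrite mulf_eq0 pnatr_eq0 (negPf w0) => /eqP.
Qed.

Lemma lp_solution_col i : \sum_j (w j)%:R * x j i <= (r i)%:R.
Proof.
rewrite (eq_bigr _ (fun j _ => weight_lp_solution j i)) -natr_sum ler_nat.
by rewrite sum_greedy_load_items // pour_le.
Qed.

Lemma lp_solution_weight :
  \sum_j (w j)%:R * (\sum_i x j i) =
  (minn (\sum_i r i) (\sum_(l <- s) w l))%:R.
Proof.
under [LHS]eq_bigr => j _ do rewrite mulr_sumr.
rewrite exchange_big /= -sum_pour natr_sum; apply: eq_bigr => i _.
rewrite (eq_bigr _ (fun j _ => weight_lp_solution j i)) -natr_sum.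
by rewrite sum_greedy_load_items.
Qed.

(* Every item contributes nonpositively to the objective difference once its
   profit is corrected by [rho] times its weight, [rho] being the density of
   the item at which the total capacity is exhausted. *)
Lemma lp_solution_optimal (y : 'I_n -> rat) :
  sorted (denser I) s ->
  (forall j, 0 <= y j <= 1) -> (forall j, j \notin s -> y j = 0) ->
  \sum_j (w j)%:R * y j <= (\sum_i r i)%:R ->
  \sum_j (p j)%:R * y j <= \sum_j \sum_i (p j)%:R * x j i.
Proof.
move=> sorted_s y01 ys wy; under [leRHS]eq_bigr do rewrite -mulr_sumr.
(* If all items fit, every row of [x] for an item of [s] sums to 1 and the comparison is
   termwise. *)
have [le_wr|lt_rw] := leqP (\sum_(l <- s) w l) (\sum_i r i).
  apply: ler_sum => j _; apply: ler_wpM2l; first exact: ler0n.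
  have [js|js] := boolP (j \in s); last by rewrite ys // sumr_ge0 // => i _;
    apply: lp_solution_ge0.
  rewrite lp_solution_row_full //; first by case/andP: (y01 j).
  exact: leq_trans (weight_through_le_sum _ _ _) le_wr.
have [c [cs le_c lt_c]] := exists_threshold uniq_s lt_rw.
(* A weightless item cannot cross a threshold, so the density [rho] is a genuine quotient. *)
have wc0 : w c != 0%N.
  by apply: contraTneq lt_c => wc0;
    rewrite weight_throughE // wc0 addn0 -leqNgt.
pose rho : rat := (p c)%:R / (w c)%:R.
have rho_ge0 : 0 <= rho by rewrite divr_ge0 ?ler0n.
have before j : denser I j c -> rho * (w j)%:R <= (p j)%:R.
  rewrite /denser; case: eqVneq => [->|wj /= /andP[_]]; first by rewrite mulr0.
  by rewrite ler_pdivlMr // ltr0n lt0n.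
have after j : denser I c j -> w j != 0%N /\ (p j)%:R <= rho * (w j)%:R.
  rewrite /denser (negPf wc0) /= => /andP[wj]; split=> //.
  by rewrite -ler_pdivrMr // ltr0n lt0n.
(* Before [c] the corrected profit is nonnegative and the row of [x] is full; after [c] it is
   nonpositive and the row is empty; at [c] it vanishes. *)
have term j : ((p j)%:R - rho * (w j)%:R) * (y j - \sum_i x j i) <= 0.
  have /andP[y_ge0 y_le1] := y01 j.
  have [js|js] := boolP (j \in s); last first.
    by rewrite ys // big1 ?subrr ?mulr0 // => i _; rewrite lp_solution_notin.
  case: (ltngtP (index j s) (index c s)) => [lt_jc|lt_cj|eq_jc].
  - have dj := before _ (sorted_ltn_index denser_trans sorted_s _ _ js cs lt_jc).
    rewrite lp_solution_row_full //; last first.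
      exact: leq_trans (weight_through_le _ lt_jc) le_c.
    by rewrite mulr_ge0_le0 ?subr_ge0 ?subr_le0.
  - have [wj dj] :=
    after _ (sorted_ltn_index denser_trans sorted_s _ _ cs js lt_cj).
    rewrite lp_solution_row_empty //; last first.
      exact: leq_trans (ltnW lt_c) (weight_through_le _ lt_cj).
    by rewrite subr0 mulr_le0_ge0 ?subr_le0.
  - have -> : j = c by rewrite -(nth_index j js) eq_jc nth_index.
    by rewrite divfK ?subrr ?mul0r // pnatr_eq0.
have : \sum_j ((p j)%:R - rho * (w j)%:R) * (y j - \sum_i x j i) <= 0.
  by apply: sumr_le0 => j _; apply: term.
have -> : \sum_j ((p j)%:R - rho * (w j)%:R) * (y j - \sum_i x j i) =
    \sum_j (p j)%:R * y j - \sum_j (p j)%:R * (\sum_i x j i) -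
    rho * (\sum_j (w j)%:R * y j - \sum_j (w j)%:R * (\sum_i x j i)).
  rewrite -!sumrB mulr_sumr -sumrB; apply: eq_bigr => j _; ring.
(* [x] uses up the joint capacity, which [y] cannot exceed, so the correction term is
   nonpositive. *)
rewrite lp_solution_weight (minn_idPl (ltnW lt_rw)).
have : rho * (\sum_j (w j)%:R * y j - (\sum_i r i)%:R) <= 0.
  by rewrite mulr_ge0_le0 ?subr_le0.
lra.
Qed.

Lemma lp_floor_le j i : (lp_floor I r s j i)%:R <= x j i.
Proof.
rewrite [lp_floor _ _ _ _ _]mxE -lt0n truncn_gt0.
case: (leP 1 (x j i)) => [|_]; first by [].
exact: lp_solution_ge0.
Qed.

Lemma lp_floor_row j : (\sum_i (lp_floor I r s j i : nat) <= 1)%N.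
Proof.
rewrite -(ler_nat rat) natr_sum; apply: le_trans (lp_solution_row_le1 j).
by apply: ler_sum => i _; apply: lp_floor_le.
Qed.

Lemma lp_floor_col i : (\sum_j w j * lp_floor I r s j i <= r i)%N.
Proof.
rewrite -(ler_nat rat) natr_sum; apply: le_trans (lp_solution_col i).
by apply: ler_sum => j _; rewrite natrM ler_wpM2l ?ler0n // lp_floor_le.
Qed.

Lemma lp_floor_in j i : lp_floor I r s j i -> j \in s.
Proof.
by rewrite mxE; apply: contraTT => js; rewrite lp_solution_notin // truncn0.
Qed.

(** An entry other than 0 and 1 needs a knapsack boundary inside the interval of [j], and then [j]
    is critical for the knapsack ending there. *)
Lemma lp_solution_integral j i :
  ~~ critical I r s j -> x j i = (lp_floor I r s j i)%:R.
Proof.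
move=> /existsPn ncj.
suff [E|E] : x j i = 0 \/ x j i = 1.
  by rewrite [lp_floor _ _ _ _ _]mxE E truncn0.
  by rewrite [lp_floor _ _ _ _ _]mxE E truncn1.
have [js|js] := boolP (j \in s); last by left; rewrite lp_solution_notin.
rewrite mxE js; have [w0|w0] := eqVneq (w j) 0%N.
  by case: eqP; [right|left].
suff [->|->] : greedy_load w r s j i = 0%N \/ greedy_load w r s j i = w j.
  by left; rewrite mul0r.
  by right; rewrite divff // pnatr_eq0.
have := greedy_loadE I r i js; rewrite /pour.
have nc (k : 'I_m) : ~~ (weight_before I s j <= \sum_(i0 < m | (i0 <= k)%N) r i0
     < weight_through I s j)%N.
  by apply: contraNN (ncj k); apply: critical_forI.
have := nc i; rewrite (weight_throughE _ js) (sum_ltnS r i).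
(* The lower boundary of knapsack [i] is the upper boundary of the preceding one, or 0 for the
   first; neither cuts the interval of [j]. *)
have : (i : nat) = 0%N /\ (\sum_(k < m | k < i) r k = 0)%N \/
    ~~ (weight_before I s j <= \sum_(k < m | k < i) r k
          < weight_before I s j + w j)%N.
  have [i0|i_gt0] := posnP i; [left|right].
    by split=> //; apply: big_pred0 => k; rewrite i0.
  have lt_i : (i.-1 < m)%N by rewrite prednK // ltnW.
  have := nc (Ordinal lt_i); rewrite (weight_throughE _ js) /=.
  rewrite (eq_bigl (fun k : 'I_m => (k < i)%N)) // => k.
  by rewrite -ltnS prednK.
move: (\sum_(k < m | (k < i)%N) r k)%N => P; lia.
Qed.

(** Rows sum to at most 1, so a critical item is charged its full profit once; all other rows are
    integral. *)
Lemma lp_value_le :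
  \sum_j \sum_i (p j)%:R * x j i <=
  (value I (lp_floor I r s) + \sum_(j | critical I r s j) p j)%:R.
Proof.
rewrite natrD /value !natr_sum [X in _ + X]big_mkcond -big_split /=.
apply: ler_sum => j _; rewrite natr_sum; case: ifPn => [_|ncj].
  apply: le_trans (_ : (p j)%:R <= _); last first.
    by rewrite lerDr sumr_ge0 // => i _; apply: ler0n.
  by rewrite -mulr_sumr ler_piMr ?ler0n // lp_solution_row_le1.
rewrite addr0; apply: ler_sum => i _.
by rewrite natrM lp_solution_integral.
Qed.

Lemma sum_critical_le (b : nat) :
  (forall j, critical I r s j -> p j <= b)%N ->
  (\sum_(j | critical I r s j) p j <= m * b)%N.
Proof.
move=> le_b.
(* Double counting of pairs: each critical item occurs with some knapsack, and each knapsack with at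
   most one item. *)
apply: (@leq_trans (\sum_(j < n) \sum_(k < m | critical_for I r s k j) p j)).
  rewrite big_mkcond; apply: leq_sum => j _; case: ifP => // /existsP[k ck].
  by rewrite (bigD1 k) //= leq_addr.
rewrite (exchange_big_dep xpredT) //= -[X in (X * b)%N]card_ord -sum_nat_const.
apply: leq_sum => k _.
have [j ckj|nc] := pickP (critical_for I r s k).
  rewrite (big_pred1 j); first by apply: le_b; apply/existsP; exists k.
  by move=> l; apply/idP/eqP => [/(critical_for_inj ckj)|->].
by rewrite big_pred0.
Qed.
End LinearRelaxation.

(** * Nodes of the branching tree *)

Lemma node_pairK n m :
  cancel (fun v : node n m => (fixed v, excluded v)) (fun z => Node z.1 z.2).
Proof. by case. Qed.

HB.instance Definition _ n m :=
  Equality.copy (node n m) (can_type (@node_pairK n m)).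

Lemma visited_tupleK n m :
  cancel (fun v : visited n m => (vnode v, order v, subsol v))
         (fun z => Visited z.1.1 z.1.2 z.2).
Proof. by case. Qed.

HB.instance Definition _ n m :=
  Equality.copy (visited n m) (can_type (@visited_tupleK n m)).

Section Nodes.
Variables (n m : nat) (I : instance n m).
Notation w := (weight I).
Notation p := (profit I).

Lemma sum_pairs (A : {set 'I_n * 'I_m}) (F : 'I_n -> 'I_m -> nat) :
  \sum_(z in A) F z.1 z.2 = \sum_j \sum_i F j i * ((j, i) \in A).
Proof.
rewrite pair_big /= big_mkcond; apply: eq_bigr => -[j i] _ /=.
by case: (_ \in _); rewrite ?muln1 ?muln0.
Qed.

Definition fixed_weight (v : node n m) (i : 'I_m) :=
  \sum_j w j * ((j, i) \in fixed v).

Lemma residualE (v : node n m) i :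
  residual I v i = capacity I i - fixed_weight v i.
Proof.
rewrite /residual /fixed_weight; congr (_ - _).
rewrite big_mkcondr /=.
rewrite (sum_pairs _ (fun j k => if k == i then w j else 0));
  apply: eq_bigr => j _.
rewrite (bigD1 i) //= eqxx big1 ?addn0 // => k /negPf->; exact: mul0n.
Qed.

Lemma fixed_profitE (v : visited n m) :
  fixed_profit I v = \sum_j \sum_i p j * ((j, i) \in fixed (vnode v)).
Proof. exact: (sum_pairs _ (fun j _ => p j)). Qed.

(** The second condition makes the subtraction in [residual] exact. *)
Definition consistent (v : node n m) : Prop :=
  (forall j, \sum_(i < m) ((j, i) \in fixed v) <= 1) /\
  (forall i, fixed_weight v i <= capacity I i).

Lemma consistent_root : consistent (root n m).
Proof.
by split=> [j|i]; rewrite /fixed_weight big1 // => k _; rewrite inE ?muln0.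
Qed.

Lemma remainingP (v : node n m) j :
  reflect (j \notin excluded v /\ forall i, (j, i) \notin fixed v)
          (j \in remaining v).
Proof.
rewrite inE; apply: (iffP andP) => -[je jf]; split=> //; last exact/forallP.
by apply/forallP.
Qed.

Definition fix_item (v : node n m) j i := Node ((j, i) |: fixed v) (excluded v).
Definition exclude_item (v : node n m) j := Node (fixed v) (j |: excluded v).

Lemma childrenP (v b : node n m) j :
  reflect ((exists2 i, w j <= residual I v i & b = fix_item v j i) \/
           b = exclude_item v j)
          (b \in children I v j).
Proof.
rewrite /children mem_rcons inE; apply: (iffP orP) => -[].
- by move/eqP; right.
- by case/mapP=> i; rewrite mem_filter => /andP[le_w _] ->; left; exists i.
- case=> i le_w ->; right; apply/mapP; exists i => //.
  by rewrite mem_filter le_w mem_enum.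
by move=> ->; left.
Qed.

Lemma fix_weight (v : node n m) j i k : j \in remaining v ->
  fixed_weight (fix_item v j i) k = fixed_weight v k + w j * (k == i).
Proof.
case/remainingP=> _ jf;
  rewrite /fixed_weight (bigD1 j) //= [in RHS](bigD1 j) //=.
rewrite !inE (negPf (jf k)) muln0 add0n orbF xpair_eqE eqxx addnC;
  congr (_ + _).
by apply: eq_bigr => l /negPf ne; rewrite !inE xpair_eqE ne.
Qed.

Lemma fix_residual (v : node n m) j i k : j \in remaining v ->
  residual I (fix_item v j i) k = residual I v k - w j * (k == i).
Proof. by move=> jr; rewrite !residualE fix_weight // subnDA. Qed.

Lemma fix_sum_residual (v : node n m) j i :
  j \in remaining v -> w j <= residual I v i ->
  \sum_k residual I (fix_item v j i) k + w j = \sum_k residual I v k.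
Proof.
move=> jr le_w;
  rewrite (bigD1 i) //= [in RHS](bigD1 i) //= fix_residual // eqxx muln1.
rewrite -addnA [X in _ + X]addnC addnA subnK //; congr (_ + _).
by apply: eq_bigr => k /negPf ne; rewrite fix_residual // ne muln0 subn0.
Qed.

Lemma fix_remaining (v : node n m) j i :
  remaining (fix_item v j i) = remaining v :\ j.
Proof.
apply/setP => l; rewrite in_setD1; apply/remainingP/andP.
  case=> le lf; split.
    by apply: contraTneq isT => lj; have := lf i; rewrite !inE lj eqxx.
  by apply/remainingP; split=> // k; have := lf k;
    rewrite !inE negb_or => /andP[].
case=> ne /remainingP[le lf]; split=> // k.
by rewrite !inE negb_or lf xpair_eqE (negPf ne).
Qed.

Lemma exclude_remaining (v : node n m) j :
  remaining (exclude_item v j) = remaining v :\ j.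
Proof. by apply/setP => l; rewrite !inE negb_or andbA. Qed.

Lemma exclude_residual (v : node n m) j :
  residual I (exclude_item v j) = residual I v.
Proof. by []. Qed.

Lemma fix_consistent (v : node n m) j i :
  j \in remaining v -> w j <= residual I v i ->
  consistent v -> consistent (fix_item v j i).
Proof.
move=> jr le_w [row col]; split=> [l|k]; last first.
  rewrite fix_weight //; have := col k; move: le_w; rewrite residualE.
  by case: eqVneq => [->|_]; rewrite ?muln1 ?muln0 ?addn0 //; lia.
have [->|ne] := eqVneq l j; last first.
  apply: leq_trans (row l); apply: leq_sum => k _.
  by rewrite !inE xpair_eqE (negPf ne).
case/remainingP: jr => _ jf.
rewrite (bigD1 i) //= big1 ?addn0 => [|k ne]; first exact: leq_b1.
by rewrite !inE xpair_eqE (negPf ne) andbF (negPf (jf k)).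
Qed.

Lemma fix_profit (v b : visited n m) j i : j \in remaining (vnode v) ->
  vnode b = fix_item (vnode v) j i -> fixed_profit I b = p j + fixed_profit I v.
Proof.
case/remainingP=> _ jf E; rewrite /fixed_profit E /= big_setU1 //=.
Qed.

Lemma candidate_sub (r : 'I_m -> nat) (s : seq 'I_n) (y : solution n m) :
  0 < m -> uniq s -> candidate I r s y ->
  [/\ forall j i, y j i -> j \in s,
      forall j, \sum_i (y j i : nat) <= 1 &
      forall i, \sum_j w j * y j i <= r i].
Proof.
move=> m_gt0 us /orP[/eqP->|/existsP[j /existsP[i /and3P[cj le_w /eqP->]]]].
  by split=> [j i|j|i];
    [exact: lp_floor_in|exact: lp_floor_row|exact: lp_floor_col].
have js : j \in s by case/existsP: cj => k /and3P[].
split=> [l k|l|k].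
- by rewrite mxE => /eqP[->].
- rewrite (bigD1 i) //= big1 ?addn0 => [|k ne]; first exact: leq_b1.
  by rewrite mxE xpair_eqE (negPf ne) andbF.
rewrite (bigD1 j) //= big1 ?addn0 => [|l ne].
  by rewrite mxE xpair_eqE eqxx /=; case: eqP => [->|_]; rewrite ?muln1 ?muln0.
by rewrite mxE xpair_eqE (negPf ne) muln0.
Qed.

Lemma bounded_exists (v : node n m) :
  exists b : visited n m, vnode b = v /\ bounded I b.
Proof.
pose s := sort (denser I) (enum (remaining v)).
have c0 : candidate I (residual I v) s (lp_floor I (residual I v) s).
  by rewrite /candidate eqxx.
pose y := [arg max_(y > lp_floor I (residual I v) s | candidate I (residual I v) s y)
   value I y].
exists (Visited v s y); split=> //; rewrite /bounded /= perm_sort perm_refl /=.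
rewrite sort_sorted; last exact: denser_total.
rewrite /y; case: arg_maxnP => //= z cz max_z; rewrite cz.
by apply/forallP => u; apply/implyP => /max_z.
Qed.

(** * Feasibility and bounds at a visited node *)

Section Visited.
Variable v : visited n m.
Hypotheses (m_gt0 : 0 < m) (bv : bounded I v).

Lemma bounded_order : uniq (order v) /\ order v =i remaining (vnode v).
Proof.
case/and4P: bv => perm _ _ _; split;
  first by rewrite (perm_uniq perm) enum_uniq.
by move=> j; rewrite (perm_mem perm) mem_enum.
Qed.

Lemma best_critical_remaining j :
  best_critical I v j -> j \in remaining (vnode v).
Proof.
by case/andP=> /existsP[k /and3P[+ _ _]] _; rewrite bounded_order.2.
Qed.

(** [subsol v] uses only remaining items, none of which is fixed, so the disjunction in
    [full_solution] joins disjoint sets of pairs. *)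
Lemma value_full_solution : value I (full_solution v) = LB I v.
Proof.
have [us sE] := bounded_order; case/and4P: bv => _ _ cand _.
have [sub _ _] := candidate_sub m_gt0 us cand.
rewrite /LB fixed_profitE /SLB /value -big_split /=; apply: eq_bigr => j _.
rewrite -big_split /=; apply: eq_bigr => i _; rewrite mxE -mulnDr;
  congr (_ * _).
case E: (subsol v j i); last by rewrite orbF.
by have := sub _ _ E; rewrite sE => /remainingP[_ /(_ i)/negPf->].
Qed.

Lemma feasible_full_solution :
  consistent (vnode v) -> feasible I (full_solution v).
Proof.
have [us sE] := bounded_order; case/and4P: bv => _ _ cand _.
have [sub row col] := candidate_sub m_gt0 us cand.
case=> frow fcol; apply/andP; split; apply/forallP; [move=> j|move=> i].
  have [js|js] := boolP (j \in remaining (vnode v)).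
    apply: leq_trans (row j); apply: leq_sum => i _; rewrite mxE.
    by case/remainingP: js => _ /(_ i)/negPf->.
  apply: leq_trans (frow j); apply: leq_sum => i _; rewrite mxE.
  case E: (subsol v j i); last by rewrite orbF.
  by have := sub _ _ E; rewrite sE (negPf js).
apply: (@leq_trans (fixed_weight (vnode v) i + \sum_j w j * subsol v j i)).
  rewrite -big_split /=; apply: leq_sum => j _; rewrite mxE -mulnDr leq_mul //.
  by case: ((j, i) \in _); case: (subsol v j i).
have := col i; have := fcol i; rewrite residualE; lia.
Qed.

Local Open Scope ring_scope.

Lemma UB_ge0 : 0 <= UB I v.
Proof.
rewrite addr_ge0 ?ler0n // sumr_ge0 // => j _; rewrite sumr_ge0 // => i _.
by rewrite mulr_ge0 ?ler0n // lp_solution_ge0.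
Qed.

Lemma fixed_profit_le_UB : (fixed_profit I v)%:R <= UB I v.
Proof.
rewrite /UB lerDr sumr_ge0 // => j _; rewrite sumr_ge0 // => i _.
by rewrite mulr_ge0 ?ler0n // lp_solution_ge0.
Qed.

(** A free bound [b] also covers nodes without critical items, where it can be 0. *)
Lemma UB_le_critical (b : nat) :
  (forall j, critical I (residual I (vnode v)) (order v) j -> p j <= b)%N ->
  UB I v <= (LB I v + m * b)%:R.
Proof.
move=> le_b; have [us _] := bounded_order.
rewrite /UB /LB addnAC natrD lerD2r.
apply: le_trans (lp_value_le _ _ m_gt0 us) _; rewrite ler_nat leq_add //.
  case/and4P: bv =>
    _ _ _ /forallP/(_ (lp_floor I (residual I (vnode v)) (order v))).
  by move/implyP; apply; rewrite /candidate eqxx.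
exact: sum_critical_le le_b.
Qed.

(** The competitor [y] obeys only the joint capacity: the greedy solution is optimal even against
    the relaxation that merges all knapsacks into one. *)
Lemma SUB_optimal (y : 'I_n -> rat) :
  (forall j, 0 <= y j <= 1) ->
  (forall j, j \notin remaining (vnode v) -> y j = 0) ->
  \sum_j (w j)%:R * y j <= (\sum_i residual I (vnode v) i)%:R ->
  \sum_j (p j)%:R * y j <= SUB I v.
Proof.
move=> y01 ys wy; have [us sE] := bounded_order;
  case/and4P: bv => _ sorted_v _ _.
by apply: lp_solution_optimal => // j; rewrite sE; apply: ys.
Qed.

Definition extends (x : solution n m) (u : node n m) : Prop :=
  (forall j i, (j, i) \in fixed u -> x j i) /\
  (forall j i, j \in excluded u -> ~~ x j i).

Lemma value_le_UB (x : solution n m) :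
  feasible I x -> extends x (vnode v) -> (value I x)%:R <= UB I v.
Proof.
case/andP=> /forallP row /forallP col [xf xe].
pose y j := if j \in remaining (vnode v) then (\sum_i x j i)%N else 0%N.
(* If the item does not remain and the pair is not fixed, [x] avoids the pair: the item is excluded,
   or fixed in another knapsack and used by [x] at most once. *)
have split_x j i : (x j i : nat) =
  ((j \in remaining (vnode v)) * x j i + ((j, i) \in fixed (vnode v)))%N.
  have [/remainingP[_ /(_ i)/negPf->]|] := boolP (j \in remaining (vnode v)).
    by rewrite mul1n addn0.
  rewrite mul0n add0n => jr; case E: (_ \in _); first by rewrite xf.
  apply/eqP; rewrite eqb0; apply: contraNN jr => xji; apply/remainingP.
  split=> [|k]; first by apply: contraL xji; apply: xe.
  apply/negP => jk; have := row j; rewrite leqNgt => /negP; apply.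
  have ne : k != i by apply: contraTneq jk => ->; rewrite E.
  by rewrite (bigD1 i) //= (bigD1 k) //= xji (xf _ _ jk).
have yE j : y j = (\sum_i (j \in remaining (vnode v)) * x j i)%N.
  by rewrite /y -big_distrr /=; case: ifP; rewrite ?mul1n ?mul0n.
have -> : (value I x)%:R =
    \sum_j (p j)%:R * (y j)%:R + (fixed_profit I v)%:R :> rat.
  under eq_bigr do rewrite -natrM; rewrite -natr_sum -natrD; congr _%:R.
  rewrite fixed_profitE -big_split; apply: eq_bigr => j _ /=.
  rewrite yE big_distrr -big_split; apply: eq_bigr => i _ /=.
  by rewrite {1}split_x mulnDr.
rewrite lerD2r; apply: SUB_optimal => [j|j|].
- rewrite ler0n lern1 /y; case: ifP => // _; exact: row.
- by rewrite /y => /negPf->.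
rewrite (eq_bigr (fun j => (w j * y j)%:R)) => [|j _]; last by rewrite natrM.
rewrite -natr_sum ler_nat.
under eq_bigr do rewrite yE big_distrr; rewrite exchange_big leq_sum //= => i _.
have : (\sum_j w j * x j i = \sum_j w j * ((j \in remaining (vnode v)) * x j i)
    + fixed_weight (vnode v) i)%N.
  by rewrite -big_split; apply: eq_bigr => j _ /=; rewrite {1}split_x mulnDr.
move=> E; have := col i;
  rewrite E residualE => /(leq_sub2r (fixed_weight (vnode v) i)).
by rewrite addnK.
Qed.
End Visited.

Local Open Scope ring_scope.

(** The child's LP solution plus the whole item [j] competes in the parent's relaxation, as fixing
    [j] consumes exactly [w j] of the joint capacity. *)
Lemma UB_fix (v b : visited n m) j i : (0 < m)%N ->
  bounded I v -> bounded I b -> j \in remaining (vnode v) ->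
  (w j <= residual I (vnode v) i)%N ->
  vnode b = fix_item (vnode v) j i -> UB I b <= UB I v.
Proof.
move=> m_gt0 bv bb jr le_w E.
have [us sE] := bounded_order bb.
pose x := lp_solution I (residual I (vnode b)) (order b).
have jb : j \notin order b by rewrite sE E fix_remaining !inE eqxx.
have xj k : x j k = 0 by apply: lp_solution_notin.
pose y l := \sum_k x l k + (l == j)%:R.
have sum_y (F : 'I_n -> rat) :
    \sum_l F l * y l = \sum_l F l * (\sum_k x l k) + F j.
  rewrite -[in RHS](mulr1 (F j)) (bigD1 j) //= [in RHS](bigD1 j) //= /y eqxx.
  rewrite big1 // mulr0 !add0r addrC; congr (_ + _).
  by apply: eq_bigr => l /negPf->; rewrite addr0.
rewrite /UB (fix_profit jr E) natrD addrA lerD2r /SUB -/x.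
under [\sum_(l < n) _]eq_bigr do rewrite -mulr_sumr.
rewrite -sum_y; apply: (SUB_optimal m_gt0 bv) => [l|l lr|].
- rewrite /y; have [->|ne] := eqVneq l j;
  first by rewrite big1 ?add0r ?ler01 ?lexx.
  rewrite addr0 lp_solution_row_le1 // andbT sumr_ge0 // => k _.
  exact: lp_solution_ge0.
- have ne : l != j by apply: contraNneq lr => ->.
  rewrite /y (negPf ne) addr0 big1 // => k _; apply: lp_solution_notin.
  by rewrite sE E fix_remaining in_setD1 negb_and (negPf lr) orbT.
rewrite sum_y lp_solution_weight // -natrD ler_nat -(fix_sum_residual jr le_w).
by rewrite leq_add2r E geq_minl.
Qed.

Lemma UB_exclude (v b : visited n m) j : (0 < m)%N ->
  bounded I v -> bounded I b ->
  vnode b = exclude_item (vnode v) j -> UB I b <= UB I v.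
Proof.
move=> m_gt0 bv bb E; have [us sE] := bounded_order bb.
have -> : UB I b = SUB I b + (fixed_profit I v)%:R.
  by rewrite /UB /fixed_profit E.
rewrite lerD2r /SUB; under [leLHS]eq_bigr do rewrite -mulr_sumr.
apply: (SUB_optimal m_gt0 bv) => [l|l lr|].
- by rewrite lp_solution_row_le1 // andbT sumr_ge0 // => k _;
  apply: lp_solution_ge0.
- rewrite big1 // => k _; apply: lp_solution_notin.
  by rewrite sE E exclude_remaining in_setD1 negb_and (negPf lr) orbT.
by rewrite lp_solution_weight // ler_nat E exclude_residual geq_minl.
Qed.
End Nodes.

(** * Runs of the algorithm *)

(* The number of words of length less than [d] with fewer than [g] occurrences
   of [m] costly letters (an item is fixed) and any number of occurrences of one
   free letter (an item is excluded). *)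
Fixpoint tree_size (m d g : nat) : nat :=
  match d, g with
  | d'.+1, g'.+1 => (tree_size m d' g + m * tree_size m d' g').+1
  | _, _ => 0
  end.

Lemma tree_size0 m d : tree_size m d 0 = 0.
Proof. by case: d. Qed.

Lemma tree_size_le m d c : 0 < m -> tree_size m d c.+1 <= d ^ c.+1 * m ^ c.
Proof.
move=> m_gt0; elim: d c => // d IH c.
rewrite [tree_size _ _ _]/=.
have := IH c; case: c => [|c].
  by rewrite tree_size0 !expn1 expn0 !muln1; lia.
move=> h; have h' := IH c.
have le_pow : d ^ c.+1 <= d.+1 ^ c.+1 by rewrite leq_exp2r.
have m_pow : 0 < m ^ c.+1 by rewrite expn_gt0 m_gt0.
have d_pow : d ^ c.+1 < d.+1 ^ c.+1 by rewrite ltn_exp2r.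
(* The two recursive terms add up to [d.+1 * d ^ c.+1 * m ^ c.+1]; the extra 1 is absorbed because
   [d ^ c.+1 < d.+1 ^ c.+1]. *)
apply: (@leq_trans (d ^ c.+2 * m ^ c.+1 + m * (d ^ c.+1 * m ^ c)).+1).
  by rewrite ltnS leq_add // leq_mul2l h' orbT.
have -> : m * (d ^ c.+1 * m ^ c) =
    d ^ c.+1 * m ^ c.+1.
  by rewrite [m ^ c.+1]expnS mulnCA.
rewrite -mulnDl expnS -[X in _ + X]mul1n -mulnDl addn1 [d.+1 ^ c.+2]expnS.
apply: (@leq_trans (d.+1 * (d ^ c.+1).+1 * m ^ c.+1)); last first.
  by rewrite leq_mul2r leq_mul2l d_pow !orbT.
by rewrite mulnS mulnDl addnC -addn1 leq_add2l muln_gt0.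
Qed.

Section Search.
Variables (n m : nat) (I : instance n m) (c : nat).
Notation w := (weight I).
Notation p := (profit I).

(** Potential of a node, bounding the nodes still to be processed in its subtree: each branching
    uses up a remaining item, and processed nodes have at most [c] fixed items. *)
Definition subtree_size (u : node n m) : nat :=
  tree_size m #|remaining u| (c.+1 - #|fixed u|).

Lemma subtree_size_children (u : node n m) j :
  j \in remaining u -> #|fixed u| <= c ->
  (\sum_(b <- children I u j) subtree_size b).+1 <= subtree_size u.
Proof.
move=> jr le_c;
  rewrite /children -cats1 big_cat big_seq1 /= big_map big_filter /=.
rewrite [subtree_size u]/subtree_size (cardsD1 j) jr subSn //= ltnS addnC.
rewrite leq_add //.
  by rewrite /subtree_size exclude_remaining subSn.
rewrite big_enum_cond /= -[X in X * _]card_ord -sum_nat_const big_mkcond.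
apply: leq_sum => i _; case: ifP => // _.
rewrite /subtree_size -/(fix_item u j i) fix_remaining /= cardsU1.
by case/remainingP: jr => _ ->; rewrite add1n subSS.
Qed.

(** The child to follow treats [j] as [x] does. If [x] puts [j] into knapsack [i], that child is not
    left out, because column [i] of [x] holds [j] together with all items fixed there. *)
Lemma extends_children (x : solution n m) (u : node n m) j :
  feasible I x -> consistent I u -> j \in remaining u -> extends x u ->
  exists2 b, b \in children I u j & extends x b.
Proof.
case/andP=> /forallP row /forallP col cu jr [xf xe].
have [i xji|xj0] := pickP (fun i => x j i); last first.
  exists (exclude_item u j); first by apply/childrenP; right.
  split=> //= l i; rewrite !inE => /orP[/eqP->|]; first by rewrite xj0.
  exact: xe.
exists (fix_item u j i); last first.
  by split=> //= l k; rewrite !inE => /orP[/eqP[-> ->]|/xf].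
apply/childrenP; left; exists i => //; rewrite residualE.
case/remainingP: jr => _ jf.
suff : w j + fixed_weight I u i <= capacity I i by lia.
apply: leq_trans (col i); rewrite /fixed_weight (bigD1 j) //= (negPf (jf i)).
rewrite muln0 add0n [leqRHS](bigD1 j) //= xji muln1 leq_add2l.
apply: leq_sum => l _; rewrite leq_mul //.
by case E: (_ \in _); rewrite // xf.
Qed.

Lemma bounded_exists_seq (us : seq (node n m)) :
  exists bs : seq (visited n m), map (@vnode n m) bs = us /\ all (bounded I) bs.
Proof.
elim: us => [|u us [bs [<- bbs]]]; first by exists [::].
by have [b [<- bb]] := bounded_exists I u; exists (b :: bs); rewrite /= bb.
Qed.

Lemma bigmax_eq0_or_mem (T : eqType) (s : seq T) (f : T -> rat) :
  (\big[Num.max/0]_(v <- s) f v = 0)%R \/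
  exists2 v, v \in s & f v = (\big[Num.max/0]_(v <- s) f v)%R.
Proof.
elim: s => [|v s IH]; first by left; rewrite big_nil.
rewrite big_cons; case: leP => _; last by right; exists v; rewrite ?mem_head.
by case: IH => [->|[u us E]]; [left|right; exists u; rewrite // inE us orbT].
Qed.

Lemma UB_le_HUB (st : state n m) v : v \in active st -> (UB I v <= HUB I st)%R.
Proof.
rewrite /HUB; elim: (active st) => // u s IH; rewrite inE big_cons le_max.
by case/orP=> [/eqP->|/IH->]; rewrite ?lexx ?orbT.
Qed.

(** * Invariant of the search, progress and approximation guarantee *)

Variables (R : realType) (alpha : R).
Hypotheses (m_gt0 : 0 < m) (alpha01 : (0 < alpha < 1)%R).
Hypothesis c_ge : (m%:R / (1 - alpha) < c.+1%:R)%R.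

(** Since [UB] never increases along a branch, this property passes from a node to its children. *)
Definition promising (v : visited n m) (j : 'I_n) : Prop :=
  ((1 - alpha) * ratr (UB I v) <= (m * p j)%:R)%R.

(** In [inv_size] the potential pays for processed nodes; [inv_cover] says that pruning loses only
    solutions of value at most [HLB]. *)
Record invariant (t : nat) (st : state n m) : Prop := Invariant {
  inv_size : t + \sum_(v <- active st) subtree_size (vnode v) <=
             tree_size m n c.+1;
  inv_bounded : {in active st, forall v, bounded I v};
  inv_consistent : {in active st, forall v, consistent I (vnode v)};
  inv_LB : {in active st, forall v, LB I v <= HLB st};
  inv_promising : {in active st, forall v z,
    z \in fixed (vnode v) -> promising v z.1};
  inv_feasible : feasible I (incumbent st);
  inv_value : value I (incumbent st) = HLB st;
  inv_cover : forall x, feasible I x -> value I x <= HLB st \/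
    exists2 v, v \in active st & extends x (vnode v) }.

Lemma initial_invariant st : initial I st -> invariant 0 st.
Proof.
case=> v [Ev bv ->]; split=> //=.
- rewrite big_seq1 Ev /subtree_size /= cards0 subn0 add0n.
  rewrite (_ : #|_| = n) // -[RHS]card_ord; apply: eq_card => j.
  by rewrite !inE; apply/forallP => i; rewrite inE.
- by move=> u; rewrite inE => /eqP->.
- by move=> u; rewrite inE => /eqP->; rewrite Ev; apply: consistent_root.
- by move=> u; rewrite inE => /eqP->.
- by move=> u; rewrite inE => /eqP-> z; rewrite Ev inE.
- by apply: feasible_full_solution => //; rewrite Ev; apply: consistent_root.
- exact: value_full_solution.
move=> x _; right; exists v; first exact: mem_head.
by rewrite Ev; split=> j i; rewrite inE.
Qed.

Lemma processed_promising t st v j :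
  invariant t st -> ~~ stopped alpha I st -> v \in active st ->
  UB I v = HUB I st -> best_critical I v j ->
  promising v j /\ #|fixed (vnode v)| <= c.
Proof.
case=> _ bnd _ lb prom _ _ _; rewrite -ltNge => ns va EU bc.
have /andP[a_gt0 a_lt1] := alpha01; have bv := bnd _ va.
have U_gap : (UB I v <= (LB I v + m * p j)%:R)%R.
  apply: UB_le_critical => // l cl.
  by case/andP: bc => _ /forallP/(_ l)/implyP; apply.
have {}U_gap : (ratr (UB I v) <= (LB I v + m * p j)%:R :> R)%R.
  by rewrite -(ratr_nat R) ler_rat.
have le_LB : ((LB I v)%:R <= (HLB st)%:R :> R)%R by rewrite ler_nat lb.
rewrite -EU in ns.
(* Combines [UB I v <= LB I v + m * p j] with [LB I v <= HLB st < alpha * UB I v]. *)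
have prom_j : promising v j by rewrite /promising; move: U_gap; rewrite natrD;
  lra.
split=> //.
have U_gt0 : (0 < ratr (UB I v) :> R)%R.
  by rewrite -(pmulr_rgt0 _ a_gt0); apply: le_lt_trans ns; apply: ler0n.
(* Summing over the fixed pairs bounds their number times [(1 - alpha) * UB I v] by [m * UB I v];
   dividing by the positive [UB I v] leaves at most [m / (1 - alpha)] pairs. *)
have : ((\sum_(z in fixed (vnode v)) (1 - alpha) * ratr (UB I v)) <=
        (m * fixed_profit I v)%:R)%R.
  rewrite /fixed_profit big_distrr natr_sum; apply: ler_sum => z zv.
  exact: prom va _ zv.
have F_le : ((fixed_profit I v)%:R <= ratr (UB I v) :> R)%R.
  by rewrite -(ratr_nat R) ler_rat fixed_profit_le_UB.
rewrite sumr_const natrM => le_F.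
rewrite -ltnS -(ltr_nat R); apply: le_lt_trans c_ge.
rewrite ler_pdivlMr ?subr_gt0 // -(ler_pM2r U_gt0) -mulrA mulr_natl.
by apply: le_trans le_F _; rewrite ler_wpM2l ?ler0n.
Qed.

Lemma step_invariant t st st' :
  invariant t st -> step alpha I st st' -> invariant t.+1 st'.
Proof.
move=> inv [ns [s1 [s2 [v [j [bs [[Ea EU] bc [Ebs bbs] [EH inc] Ea']]]]]]].
have va : v \in active st by rewrite Ea mem_cat mem_head orbT.
have [prom_j le_c] := processed_promising inv ns va EU bc.
case: inv => size bnd cons lb prom feas val cover.
have bv := bnd _ va; have cv := cons _ va.
have jr := best_critical_remaining bv bc.
have /allP bb := bbs.
have child b : b \in bs -> vnode b \in children I (vnode v) j.
  by move=> b_bs; rewrite -Ebs map_f.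
have le_HLB : HLB st <= HLB st' by rewrite EH leq_maxl.
have child_cons b : b \in bs -> consistent I (vnode b).
  by move=> /child/childrenP[[i le_w ->]|-> //]; apply: fix_consistent.
have child_LB b : b \in bs -> LB I b <= HLB st'.
  move=> b_bs; rewrite EH; apply: leq_trans (leq_maxr _ _).
  exact: leq_bigmax_seq.
have child_UB b : b \in bs -> (UB I b <= UB I v)%R.
  move=> b_bs; case/childrenP: (child _ b_bs) => [[i le_w E]|E].
    exact: UB_fix (bb _ b_bs) jr le_w E.
  exact: UB_exclude (bb _ b_bs) E.
have child_prom b : b \in bs -> forall z, z \in fixed (vnode b) ->
  promising b z.1.
  move=> b_bs z zb; have : promising v z.1.
    move: zb; case/childrenP: (child _ b_bs) => [[i le_w ->]|->] /=.
      by rewrite !inE => /orP[/eqP-> //|]; apply: prom.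
    exact: prom.
  apply: le_trans; have /andP[_ a_lt1] := alpha01.
  by rewrite ler_wpM2l ?ler_rat ?child_UB // subr_ge0 ltW.
have activeE u : u \in active st' -> u \in active st \/ u \in bs.
  rewrite Ea' Ea !mem_cat inE mem_filter.
  by case/or3P=> [->|->|/andP[_ ->]]; rewrite ?orbT; auto.
split.
(* The potential of [v] pays for its processing and for all its children, pruned or not. *)
- apply: leq_trans size; rewrite Ea' Ea !big_cat big_cons /=.
  have : (\sum_(b <- [seq b <- bs | ((HLB st')%:R <= UB I b)%R])
      subtree_size (vnode b)).+1 <= subtree_size (vnode v).
    apply: leq_trans (subtree_size_children jr le_c).
    rewrite ltnS -Ebs big_map big_filter big_mkcond; apply: leq_sum => b _.
    by case: ifP.
  lia.
- by move=> u /activeE[/bnd|/bb].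
- by move=> u /activeE[/cons|/child_cons].
- by move=> u /activeE[/lb/leq_trans->|/child_LB].
- by move=> u /activeE[/prom|/child_prom].
- move: inc; rewrite inE => /orP[/eqP[-> _] //|/mapP[b b_bs [-> _]]].
  by apply: feasible_full_solution; auto.
- move: inc; rewrite inE => /orP[/eqP[-> ->] //|/mapP[b b_bs [-> ->]]].
  by apply: value_full_solution; auto.
move=> x fx; case: (cover _ fx) => [le_x|[u ua xu]].
  by left; apply: leq_trans le_HLB.
have [le_x|lt_x] := leqP (value I x) (HLB st'); [by left|right].
move: ua; rewrite Ea mem_cat inE orbCA => /predU1P[Eu|u12]; last first.
  by exists u => //; rewrite Ea' catA mem_cat mem_cat u12.
move: xu; rewrite {}Eu => xv.
(* The child followed by [x] survives pruning: its upper bound is at least the value of [x], which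
   exceeds [HLB st']. *)
have [b0 + xb] := extends_children fx cv jr xv.
rewrite -Ebs => /mapP[b b_bs Eb]; rewrite {}Eb in xb; exists b => //.
rewrite Ea' !mem_cat mem_filter b_bs andbT; apply/or3P/Or33.
apply: le_trans (_ : (value I x)%:R <= _)%R; first by rewrite ler_nat ltnW.
by apply: value_le_UB; auto.
Qed.

Lemma run_invariant t st : run alpha I t st -> invariant t st.
Proof.
elim=> [{}st|{}t {}st st' _]; [exact: initial_invariant|exact: step_invariant].
Qed.

Lemma step_exists t st :
  invariant t st -> ~~ stopped alpha I st -> exists st', step alpha I st st'.
Proof.
move=> inv ns; have /andP[a_gt0 a_lt1] := alpha01.
have H_gt : ((HLB st)%:R < alpha * ratr (HUB I st))%R by rewrite ltNge.
(* If the maximum were its default value 0, the algorithm would have stopped; hence some active node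
   attains [HUB]. *)
have [H0|[v va EU]] := bigmax_eq0_or_mem (active st) (UB I).
  by move: H_gt; rewrite /HUB H0 rmorph0 mulr0 ltNge ler0n.
rewrite -/(HUB I st) in EU; have bv := inv_bounded inv va.
have [j bc] : exists j, best_critical I v j.
  have [j0 cj0|nc] := pickP (critical I (residual I (vnode v)) (order v)).
    exists [arg max_(j > j0 | critical I (residual I (vnode v)) (order v) j) p j].
    rewrite /best_critical; case: arg_maxnP => // j cj max_j; rewrite cj /=.
    by apply/forallP => l; apply/implyP => /max_j.
  (* Without critical items [UB I v] is at most [LB I v], hence at most [HLB st], and the algorithm
     would have stopped. *)
  have : (UB I v <= (LB I v + m * 0)%:R)%R.
    by apply: UB_le_critical => // l; rewrite nc.
  rewrite muln0 addn0 -(ler_rat R) ratr_nat EU => le_U.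
  have : (alpha * ratr (HUB I st) <= ratr (HUB I st))%R.
    by rewrite ler_piMl ?(ltW a_lt1) // -EU ler0q UB_ge0.
  have : ((LB I v)%:R <= (HLB st)%:R :> R)%R by rewrite ler_nat (inv_LB inv va).
  by move: H_gt le_U; lra.
have [bs [Ebs bbs]] := bounded_exists_seq (children I (vnode v) j).
have [s1 [s2 Ea]] : exists s1 s2, active st = s1 ++ v :: s2.
  by case/splitPr: va => s1 s2; exists s1, s2.
pose H := maxn (HLB st) (\max_(b <- bs) LB I b).
have [x xH] : exists x, (x, H) \in
    (incumbent st, HLB st) :: [seq (full_solution b, LB I b) | b <- bs].
  rewrite /H; elim: bs {Ebs bbs H} => [|b bs [x IH]].
    by exists (incumbent st); rewrite big_nil maxn0 mem_head.
  rewrite big_cons maxnCA; case: (leqP (LB I b)) => _.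
    by exists x; move: IH; rewrite !inE => /orP[->|->]; rewrite ?orbT.
  by exists (full_solution b); rewrite !inE eqxx orbT.
exists (State (s1 ++ s2 ++ [seq b <- bs | (H%:R <= UB I b)%R]) x H).
by split=> //; exists s1, s2, v, j, bs.
Qed.

Lemma stopped_optimal t st : invariant t st -> stopped alpha I st ->
  (alpha * (opt I)%:R <= (value I (incumbent st))%:R)%R.
Proof.
move=> inv stop; have /andP[a_gt0 a_lt1] := alpha01.
rewrite (inv_value inv).
(* A feasible solution has value at most [HLB st] or extends an active node, and is then dominated
   by [HUB]. *)
have bnd x : feasible I x -> (alpha * (value I x)%:R <= (HLB st)%:R)%R.
  move=> fx; case: (inv_cover inv fx) => [le_x|[v va xv]].
    apply: le_trans (_ : (value I x)%:R <= _)%R; last by rewrite ler_nat.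
    by rewrite ler_piMl ?ler0n // ltW.
  apply: le_trans stop; rewrite ler_pM2l // -(ratr_nat R) ler_rat.
  apply: le_trans (UB_le_HUB va).
  by apply: value_le_UB => //; exact: inv_bounded inv _ va.
rewrite /opt; elim/big_ind: _ => [|a b ha hb|x /bnd //].
  by rewrite mulr0 ler0n.
by case: (leqP a b).
Qed.
End Search.

Theorem theorem1 (R : realType) :
  exists K : nat,
  forall (m : nat) (alpha : R), (0 < m)%N -> (0 < alpha < 1)%R ->
  exists c : nat,
  forall (n : nat) (I : instance n m),
    (exists st : state n m, initial I st) /\
    forall (t : nat) (st : state n m), run alpha I t st ->
      [/\ (t <= K * (n ^ c.+1 * m ^ c))%N,
          ~~ stopped alpha I st -> exists st' : state n m, step alpha I st st' &
          stopped alpha I st ->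
            feasible I (incumbent st) /\
            (alpha * (opt I)%:R <= (value I (incumbent st))%:R)%R].
Proof.
(* The constant 1 suffices by [tree_size_le]; [c] is the integer part of [m / (1 - alpha)], so that
   [m / (1 - alpha) < c.+1]. *)
exists 1 => m alpha m_gt0 alpha01; exists (Num.truncn (m%:R / (1 - alpha))%R).
move=> n I; split.
  have [v [Ev bv]] := bounded_exists I (root n m).
  by exists (State [:: v] (full_solution v) (LB I v)), v.
move=> t st /(run_invariant m_gt0 alpha01 (truncnS_gt _)) inv; split.
- rewrite mul1n; apply: leq_trans (tree_size_le _ _ m_gt0).
  exact: leq_trans (leq_addr _ _) (inv_size inv).
- exact: step_exists inv.
by move=> stop; split;
  [exact: inv_feasible inv|exact: stopped_optimal inv stop].
Qed.
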